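(* Let $\mathcal{B}$ be a $C^*$-algebra and $E$ a Hilbert $\mathcal{B}$-module. Then the quotient of the generalized unitary group $U^{gen}(E)$ by its normal subgroup $U(E)$ is $$U^{gen}(E)/U(E)=\Phi_E,$$ where the identification sends the class of a $\varphi$-unitary $u$ on $E$ to $[\varphi]_E$.
   Context: Inner products are $\mathcal{B}$-linear in the second argument. For an automorphism $\varphi$ of $\mathcal{B}$, a $\varphi$-unitary on $E$ is a surjective map $u\colon E\to E$ with $\langle ux,uy\rangle=\varphi(\langle x,y\rangle)$ for all $x,y\in E$. $U^{gen}(E)$ is the group (under composition) of all maps that are $\varphi$-unitaries on $E$ for some automorphism $\varphi$ of $\mathcal{B}$. $U(E)$ is the group of unitaries in the algebra $\mathcal{B}^a(E)$ of adjointable operators on $E$, i.e. of $\mathrm{id}_{\mathcal{B}}$-unitaries. Put $\mathcal{B}_E=\overline{\mathrm{span}}\langle E,E\rangle$. For an automorphism $\varphi$ of $\mathcal{B}$, $[\varphi]_E$ is the set of all automorphisms of $\mathcal{B}$ that coincide with $\varphi$ on $\mathcal{B}_E$, and $\Phi_E=\{[\varphi]_E:\text{there exists a }\varphi\text{-unitary on }E\}$, which is a group under $[\varphi]_E[\varphi']_E=[\varphi\circ\varphi']_E$. *)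

(* Defs.v *)
From HB Require Import structures.
From mathcomp Require Import all_boot all_order all_algebra.
From mathcomp Require Import complex.
From mathcomp Require Import all_classical all_reals all_analysis.

Set Implicit Arguments.
Unset Strict Implicit.
Unset Printing Implicit Defensive.

Import Order.TTheory GRing.Theory Num.Theory.
Import numFieldNormedType.Exports.

Local Open Scope classical_set_scope.
Local Open Scope quotient_scope.
Local Open Scope ring_scope.

(* C*-algebras are complex and need not be unital, so they cannot be built on
   the ring and algebra structures of MathComp, which have a unit.  On R[i] the
   norm takes its values in the nonnegative reals. *)
HB.mixin Record isCStarAlgebra (R : realType) B
    of CompleteNormedModule R[i] B := {
  cmul : B -> B -> B ;
  cstar : B -> B ;
  cmulA : associative cmul ;
  cmul_linearl : forall (c : R[i]) (a a' b : B),
    cmul (c *: a + a') b = c *: cmul a b + cmul a' b ;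
  cmul_linearr : forall (c : R[i]) (a b b' : B),
    cmul a (c *: b + b') = c *: cmul a b + cmul a b' ;
  cstarK : involutive cstar ;
  cstar_antilinear : forall (c : R[i]) (a b : B),
    cstar (c *: a + b) = c^* *: cstar a + cstar b ;
  cstarM : forall a b : B, cstar (cmul a b) = cmul (cstar b) (cstar a) ;
  norm_cmul : forall a b : B, `|cmul a b| <= `|a| * `|b| ;
  norm_cstar : forall a : B, `|cmul (cstar a) a| = `|a| ^+ 2
}.

#[short(type="cStarAlgType")]
HB.structure Definition CStarAlgebra (R : realType) :=
  {B of isCStarAlgebra R B & CompleteNormedModule R[i] B}.

Definition cpositive (R : realType) (B : cStarAlgType R) (a : B) : Prop :=
  exists b : B, a = cmul (cstar b) b.

(* The field norm_ip says that the norm of E is the one given by the inner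
   product; that norm is complete because E is a completeNormedModType.
   Definiteness of the inner product follows from it. *)
HB.mixin Record isHilbertModule (R : realType) (B : cStarAlgType R) E
    of CompleteNormedModule R[i] E := {
  mact : E -> B -> E ;
  ip : E -> E -> B ;
  mactA : forall (x : E) (a b : B), mact (mact x a) b = mact x (cmul a b) ;
  mact_linearl : forall (c : R[i]) (x y : E) (b : B),
    mact (c *: x + y) b = c *: mact x b + mact y b ;
  mact_linearr : forall (c : R[i]) (x : E) (a b : B),
    mact x (c *: a + b) = c *: mact x a + mact x b ;
  ip_linearr : forall (c : R[i]) (x y z : E),
    ip x (c *: y + z) = c *: ip x y + ip x z ;
  ip_mactr : forall (x y : E) (b : B), ip x (mact y b) = cmul (ip x y) b ;
  ip_cstar : forall x y : E, cstar (ip x y) = ip y x ;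
  ip_positive : forall x : E, cpositive (ip x x) ;
  norm_ip : forall x : E, `|x| ^+ 2 = `|ip x x|
}.

#[short(type="hilbertModType")]
HB.structure Definition HilbertModule (R : realType) (B : cStarAlgType R) :=
  {E of isHilbertModule R B E & CompleteNormedModule R[i] E}.

Arguments hilbertModType {R} B.

Record is_automorphism (R : realType) (B : cStarAlgType R) (phi : B -> B) :
    Prop := IsAutomorphism {
  aut_bij : bijective phi ;
  aut_linear : forall (c : R[i]) (a b : B),
    phi (c *: a + b) = c *: phi a + phi b ;
  aut_mul : {morph phi : a b / cmul a b} ;
  aut_star : {morph phi : a / cstar a}
}.

Record phi_unitary (R : realType) (B : cStarAlgType R) (E : hilbertModType B)
    (phi : B -> B) (u : E -> E) : Prop := PhiUnitary {
  phi_unitary_surj : forall y : E, exists x : E, u x = y ;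
  phi_unitary_ip : forall x y : E, ip (u x) (u y) = phi (ip x y)
}.

Definition gen_unitary (R : realType) (B : cStarAlgType R)
    (E : hilbertModType B) (u : E -> E) : Prop :=
  exists2 phi : B -> B, is_automorphism phi & phi_unitary phi u.

Definition is_adjoint (R : realType) (B : cStarAlgType R)
    (E : hilbertModType B) (a b : E -> E) : Prop :=
  forall x y : E, ip (a x) y = ip x (b y).

(* Adjointable maps are automatically linear, so this is unitarity in the
   algebra of adjointable operators. *)
Definition is_unitary (R : realType) (B : cStarAlgType R)
    (E : hilbertModType B) (a : E -> E) : Prop :=
  exists b : E -> E, [/\ is_adjoint a b, cancel a b & cancel b a].

Definition lin_span (R : realType) (V : lmodType R[i]) (S : set V) : set V :=
  [set v | exists (n : nat) (c : 'I_n -> R[i]) (s : 'I_n -> V),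
     (forall i, S (s i)) /\ v = \sum_(i < n) c i *: s i].

Definition range_ideal (R : realType) (B : cStarAlgType R)
    (E : hilbertModType B) : set B :=
  closure (lin_span [set b : B | exists x y : E, b = ip x y]).

Definition aut_class (R : realType) (B : cStarAlgType R)
    (E : hilbertModType B) (phi : B -> B) : set (B -> B) :=
  [set psi | is_automorphism psi /\
             forall b : B, range_ideal E b -> psi b = phi b].

Definition Phi (R : realType) (B : cStarAlgType R) (E : hilbertModType B) :
    set (set (B -> B)) :=
  [set aut_class E phi | phi in
     [set phi | is_automorphism phi /\
                exists u : E -> E, phi_unitary phi u]].

(* The union over all representatives: a definition of the product that does
   not presuppose that the class of the composite is independent of them. *)
Definition class_mul (R : realType) (B : cStarAlgType R)
    (E : hilbertModType B) (X Y : set (B -> B)) : set (B -> B) :=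
  \bigcup_(phi in X) \bigcup_(psi in Y) aut_class E (phi \o psi).

Record is_group (T : Type) (G : set T) (op : T -> T -> T) : Prop := IsGroup {
  is_group_closed : forall x y, G x -> G y -> G (op x y) ;
  is_group_assoc : forall x y z, G x -> G y -> G z ->
    op x (op y z) = op (op x y) z ;
  is_group_unit : exists e, [/\ G e,
    forall x, G x -> op e x = x /\ op x e = x &
    forall x, G x -> exists y, [/\ G y, op y x = e & op x y = e]]
}.

Section UnitaryLemmas.
Variables (R : realType) (B : cStarAlgType R) (E : hilbertModType B).
Implicit Types (x y z : E) (u v : E -> E) (phi psi : B -> B).

Lemma ipBr x y z : ip x (y - z) = ip x y - ip x z :> B.
Proof. by rewrite addrC -scaleN1r ip_linearr scaleN1r addrC. Qed.

Lemma cstarB (a b : B) : cstar (a - b) = cstar a - cstar b.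
Proof.
by rewrite addrC -scaleN1r cstar_antilinear rmorphN1 scaleN1r addrC.
Qed.

Lemma ipBl x y z : ip (x - y) z = ip x z - ip y z :> B.
Proof. by rewrite -ip_cstar ipBr cstarB !ip_cstar. Qed.

Lemma ip_eq0 x : ip x x = 0 :> B -> x = 0.
Proof.
move=> x0; apply/normr0_eq0/eqP; rewrite -sqrf_eq0.
by rewrite norm_ip x0 normr0.
Qed.

Lemma autB phi a b : is_automorphism phi -> phi (a - b) = phi a - phi b.
Proof.
by case=> _ lin _ _; rewrite addrC -scaleN1r lin scaleN1r addrC.
Qed.

Lemma aut_id : is_automorphism (@id B).
Proof. by split=> //; exists id. Qed.

Lemma aut_comp phi psi :
  is_automorphism phi -> is_automorphism psi -> is_automorphism (phi \o psi).
Proof.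
move=> [bp lp mp sp] [bq lq mq sq]; split.
- exact: bij_comp.
- by move=> c a b /=; rewrite lq lp.
- by move=> a b /=; rewrite mq mp.
- by move=> a /=; rewrite sq sp.
Qed.

Lemma aut_inv phi psi : is_automorphism phi -> cancel phi psi ->
  cancel psi phi -> is_automorphism psi.
Proof.
move=> [bp lp mp sp] phiK psiK; split.
- by exists phi.
- by move=> c a b; apply: (can_inj phiK); rewrite lp !psiK.
- by move=> a b; apply: (can_inj phiK); rewrite mp !psiK.
- by move=> a; apply: (can_inj phiK); rewrite sp !psiK.
Qed.

Lemma gen_unitary_inj u : gen_unitary u -> injective u.
Proof.
move=> [phi aphi [_ uphi]] x y uxy; apply/subr0_eq; apply: ip_eq0.
have phiI := bij_inj (aut_bij aphi); apply: phiI.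
rewrite ipBl !ipBr !(autB _ _ aphi) -!uphi uxy !subrr.
by rewrite -[X in phi X](subrr (0 : B)) (autB _ _ aphi) subrr.
Qed.

Lemma gen_unitary_bij u : gen_unitary u -> bijective u.
Proof.
move=> gu; have uI := gen_unitary_inj gu.
have [phi _ [/choice[v vK] _]] := gu.
by exists v => // x; apply: uI; rewrite vK.
Qed.

Lemma gen_unitary_id : gen_unitary (@id E).
Proof. by exists id; [exact: aut_id | split=> // y; exists y]. Qed.

Lemma gen_unitary_comp u v :
  gen_unitary u -> gen_unitary v -> gen_unitary (u \o v).
Proof.
move=> [phi aphi [su uphi]] [psi apsi [sv vpsi]].
exists (phi \o psi); first exact: aut_comp.
split=> [y|x y /=]; last by rewrite uphi vpsi.
by have [x <-] := su y; have [z <-] := sv x; exists z.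
Qed.

Lemma gen_unitary_inv u v : gen_unitary u -> cancel u v -> cancel v u ->
  gen_unitary v.
Proof.
move=> [phi aphi [su uphi]] uK vK.
have [[psi phiK psiK] _ _ _] := aphi.
exists psi; first exact: aut_inv phiK psiK.
split=> [y|x y]; first by exists (u y); rewrite uK.
by apply: (can_inj phiK); rewrite psiK -uphi !vK.
Qed.

Lemma is_unitary_id : is_unitary (@id E).
Proof. by exists id; split. Qed.

Lemma is_unitary_comp u v :
  is_unitary u -> is_unitary v -> is_unitary (u \o v).
Proof.
move=> [u' [au uK u'K]] [v' [av vK v'K]]; exists (v' \o u'); split.
- by move=> x y /=; rewrite au av.
- exact: can_comp.
- exact: can_comp.
Qed.

Lemma is_unitary_inv u v : is_unitary u -> cancel u v -> is_unitary v.
Proof.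
move=> [u' [au uK u'K]] vK.
have vE : v = u' by apply/funext => x; rewrite -[in LHS](u'K x) vK.
exists u; rewrite vE; split=> // x y.
by rewrite -ip_cstar -au ip_cstar.
Qed.

Lemma is_unitary_conj u u' v : gen_unitary u -> cancel u u' -> cancel u' u ->
  is_unitary v -> is_unitary (u \o v \o u').
Proof.
move=> [phi _ [_ uphi]] uK u'K [v' [av vK v'K]].
exists (u \o v' \o u'); split=> [x y|x|x] /=.
- by rewrite -[y in LHS]u'K uphi av -uphi u'K.
- by rewrite uK vK u'K.
- by rewrite uK v'K u'K.
Qed.

End UnitaryLemmas.

Section GeneralizedUnitaryGroup.
Variables (R : realType) (B : cStarAlgType R) (E : hilbertModType B).

Definition Ugen : Type := {u : E -> E | `[< gen_unitary u >]}.

HB.instance Definition _ := SubType.on Ugen.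
HB.instance Definition _ := Choice.on Ugen.

Lemma UgenP (u : Ugen) : gen_unitary (val u).
Proof. exact/asboolP/(valP u). Qed.

Definition MkUgen (u : E -> E) (gu : gen_unitary u) : Ugen :=
  exist (fun u : E -> E => `[< gen_unitary u >]) u (asboolT gu).

Definition Ugen_one : Ugen := MkUgen (gen_unitary_id E).

Definition Ugen_mul (u v : Ugen) : Ugen :=
  MkUgen (gen_unitary_comp (UgenP u) (UgenP v)).

Fact Ugen_inv_subproof (u : Ugen) :
  {v : Ugen | cancel (val u) (val v) & cancel (val v) (val u)}.
Proof.
have : exists v : Ugen, cancel (val u) (val v) /\ cancel (val v) (val u).
  have [v uK vK] := gen_unitary_bij (UgenP u).
  by exists (MkUgen (gen_unitary_inv (UgenP u) uK vK)).
by move=> /cid[v [uK vK]]; exists v.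
Qed.

Definition Ugen_inv (u : Ugen) : Ugen := s2val (Ugen_inv_subproof u).

Fact Ugen_mulA : associative Ugen_mul.
Proof. by move=> u v w; exact: val_inj. Qed.

Fact Ugen_mul1 : left_id Ugen_one Ugen_mul.
Proof. by move=> u; exact: val_inj. Qed.

Fact Ugen_mulr1 : right_id Ugen_one Ugen_mul.
Proof. by move=> u; exact: val_inj. Qed.

Fact Ugen_mulV : left_inverse Ugen_one Ugen_inv Ugen_mul.
Proof.
move=> u; apply: val_inj; apply/funext => x /=.
by rewrite /Ugen_inv; case: (Ugen_inv_subproof u) => v /= uK _; exact: uK.
Qed.

Fact Ugen_mulrV : right_inverse Ugen_one Ugen_inv Ugen_mul.
Proof.
move=> u; apply: val_inj; apply/funext => x /=.
by rewrite /Ugen_inv; case: (Ugen_inv_subproof u) => v /= _ vK; exact: vK.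
Qed.

HB.instance Definition _ := isGroup.Build Ugen
  Ugen_mulA Ugen_mul1 Ugen_mulr1 Ugen_mulV Ugen_mulrV.

Local Open Scope group_scope.

Lemma val_UgenM (u v : Ugen) : val (u * v) = val u \o val v.
Proof. by []. Qed.

Lemma val_UgenVK (u : Ugen) : cancel (val u^-1) (val u).
Proof. by move=> x; rewrite -[LHS]/(val (u * u^-1) x) mulgV. Qed.

Lemma val_UgenKV (u : Ugen) : cancel (val u) (val u^-1).
Proof. by move=> x; rewrite -[LHS]/(val (u^-1 * u) x) mulVg. Qed.

Definition U : {pred Ugen} := fun u => `[< is_unitary (val u) >].

Fact U_mulg_closed : mulg_closed U.
Proof.
by move=> u v /asboolP uU /asboolP vU; apply/asboolP; exact: is_unitary_comp.
Qed.

Fact U_one : 1 \in U.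
Proof. by apply/asboolP; exact: is_unitary_id. Qed.

Fact U_invg_closed : invg_closed U.
Proof.
move=> u /asboolP uU; apply/asboolP.
exact: is_unitary_inv uU (val_UgenKV u).
Qed.

HB.instance Definition _ := isMulClosed.Build Ugen U U_mulg_closed.
HB.instance Definition _ := isMul1Closed.Build Ugen U U_one.
HB.instance Definition _ := isInvClosed.Build Ugen U U_invg_closed.

Lemma U_normal (u v : Ugen) : v \in U -> v ^ u \in U.
Proof.
move=> /asboolP vU; apply/asboolP.
exact: (is_unitary_conj (UgenP u^-1) (val_UgenVK u) (val_UgenKV u) vU).
Qed.

Definition Ucoset_eq (u v : Ugen) : bool := u^-1 * v \in U.

Fact Ucoset_eq_refl : reflexive Ucoset_eq.
Proof. by move=> u; rewrite /Ucoset_eq mulVg gpred1. Qed.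

Fact Ucoset_eq_sym : symmetric Ucoset_eq.
Proof.
by move=> u v; rewrite /Ucoset_eq -[in LHS]gpredV invgM invgK.
Qed.

Fact Ucoset_eq_trans : transitive Ucoset_eq.
Proof.
move=> v u w uv vw; rewrite /Ucoset_eq.
by have := gpredM _ _ uv vw; rewrite mulgA mulgK.
Qed.

Canonical Ucoset_equiv :=
  EquivRel Ucoset_eq Ucoset_eq_refl Ucoset_eq_sym Ucoset_eq_trans.

Definition UgenQ : Type := {eq_quot Ucoset_eq}.

HB.instance Definition _ := Choice.on UgenQ.
HB.instance Definition _ := EqQuotient.on UgenQ.

Definition UgenQ_one : UgenQ := \pi_UgenQ 1.
Definition UgenQ_inv (x : UgenQ) : UgenQ := \pi_UgenQ (repr x)^-1.
Definition UgenQ_mul (x y : UgenQ) : UgenQ := \pi_UgenQ (repr x * repr y).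

Lemma UgenQ_eqP (u v : Ugen) : \pi_UgenQ u = \pi v <-> u^-1 * v \in U.
Proof. by split=> [/eqmodP|h]; [|apply/eqmodP]. Qed.

Lemma UgenQ_repr (u : Ugen) : u^-1 * repr (\pi_UgenQ u) \in U.
Proof. by apply/UgenQ_eqP; rewrite reprK. Qed.

Lemma UgenQ_piM (u v : Ugen) : \pi_UgenQ (u * v) = UgenQ_mul (\pi u) (\pi v).
Proof.
apply/UgenQ_eqP; set u' := repr _; set v' := repr _.
have -> : (u * v)^-1 * (u' * v') = (u^-1 * u') ^ v * (v^-1 * v').
  by rewrite /conjg invgM !mulgA mulgK.
by apply: gpredM; [apply: U_normal|]; exact: UgenQ_repr.
Qed.

Lemma UgenQ_piV (u : Ugen) : \pi_UgenQ u^-1 = UgenQ_inv (\pi u).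
Proof.
apply/UgenQ_eqP; set u' := repr _; rewrite invgK.
have -> : u * u'^-1 = (u'^-1 * u) ^ u^-1 by rewrite /conjg invgK !mulgA mulgK.
by apply: U_normal; rewrite -gpredV invgM invgK; exact: UgenQ_repr.
Qed.

Fact UgenQ_mulA : associative UgenQ_mul.
Proof.
by elim/quotW=> u; elim/quotW=> v; elim/quotW=> w; rewrite -!UgenQ_piM mulgA.
Qed.

Fact UgenQ_mul1 : left_id UgenQ_one UgenQ_mul.
Proof. by elim/quotW=> u; rewrite -UgenQ_piM mul1g. Qed.

Fact UgenQ_mulr1 : right_id UgenQ_one UgenQ_mul.
Proof. by elim/quotW=> u; rewrite -UgenQ_piM mulg1. Qed.

Fact UgenQ_mulV : left_inverse UgenQ_one UgenQ_inv UgenQ_mul.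
Proof. by elim/quotW=> u; rewrite -UgenQ_piV -UgenQ_piM mulVg. Qed.

Fact UgenQ_mulrV : right_inverse UgenQ_one UgenQ_inv UgenQ_mul.
Proof. by elim/quotW=> u; rewrite -UgenQ_piV -UgenQ_piM mulgV. Qed.

HB.instance Definition _ := isGroup.Build UgenQ
  UgenQ_mulA UgenQ_mul1 UgenQ_mulr1 UgenQ_mulV UgenQ_mulrV.

End GeneralizedUnitaryGroup.

Arguments U {R B} E.

(* Main.v *)
Require Import Defs.
From mathcomp Require Import all_boot all_order all_algebra.
From mathcomp Require Import complex.
From mathcomp Require Import all_classical all_reals all_analysis.

Set Implicit Arguments.
Unset Strict Implicit.
Unset Printing Implicit Defensive.

Import Order.TTheory GRing.Theory Num.Theory.
Import numFieldNormedType.Exports.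

Local Open Scope classical_set_scope.
Local Open Scope quotient_scope.
Local Open Scope group_scope.

(** An automorphism phi that admits a phi-unitary u is determined by u on the
    inner products, since phi (ip x y) = ip (u x) (u y).  The point is that it
    is then determined on the whole of the closed ideal B_E that they span
    (phi_unitary_agree).  One could invoke the automatic continuity of
    automorphisms of C*-algebras, but this rests on spectral theory; an
    algebraic argument, which uses only that multiplication is continuous,
    that the inner products are stable under left multiplication by B, and
    that a^* a = 0 forces a = 0, is given in aut_fix_closure.

    So aut_class E phi depends on u only, and this yields everything else.
    First, if phi' and psi' represent the classes of phi and psi, then a
    phi-unitary is a phi'-unitary and a psi-unitary is a psi'-unitary, so the
    composite of the two implements phi \o psi as well as phi' \o psi', and
    the product of classes is well defined (class_mulE).  Secondly,
    u |-> aut_class E phi is multiplicative, and two generalized unitaries u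
    and v have the same class exactly when u^-1 * v preserves inner products,
    that is, when it is unitary.  Hence there is a bijective multiplicative
    map theta from U^gen(E) / U(E) to Phi E, and Phi E is a group because it is
    the image of a group under a multiplicative map. *)

(** * Automorphisms that fix a left-stable set *)

Section Automorphisms.
Context {R : realType} {B : cStarAlgType R}.
Local Open Scope ring_scope.
Implicit Types (a b c d : B) (S : set B) (phi psi : B -> B).

Lemma cmul0r d : cmul d 0 = 0.
Proof.
have := cmul_linearr 1 d 0 0; rewrite scale1r addr0 scale1r => h.
by apply: (addrI (cmul d 0)); rewrite addr0 -h.
Qed.

Lemma cmulBl a b c : cmul (a - b) c = cmul a c - cmul b c.
Proof. by rewrite addrC -scaleN1r cmul_linearl scaleN1r addrC. Qed.

Lemma cmulBr a b c : cmul a (b - c) = cmul a b - cmul a c.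
Proof. by rewrite addrC -scaleN1r cmul_linearr scaleN1r addrC. Qed.

Lemma cmul_sumr d n (k : 'I_n -> R[i]) (s : 'I_n -> B) :
  cmul d (\sum_(i < n) k i *: s i) = \sum_(i < n) k i *: cmul d (s i).
Proof.
elim/big_rec2: _ => [|i y x _ <-]; first exact: cmul0r.
by rewrite cmul_linearr.
Qed.

Lemma cstar_cmul_eq0 a : cmul (cstar a) a = 0 -> a = 0.
Proof.
move=> a0; apply/normr0_eq0/eqP; rewrite -sqrf_eq0.
by rewrite -norm_cstar a0 normr0.
Qed.

Lemma aut0 phi : is_automorphism phi -> phi 0 = 0.
Proof. by move=> aphi; rewrite -[X in phi X](subrr 0) autB// subrr. Qed.

Lemma lin_span_sub {V : lmodType R[i]} (S : set V) : S `<=` lin_span S.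
Proof.
move=> s Ss; exists 1%N, (fun=> 1), (fun=> s); split=> //.
by rewrite big_ord1 scale1r.
Qed.

Lemma cmul_closure_eq0 S d b :
  (forall s, S s -> cmul d s = 0) -> closure (lin_span S) b -> cmul d b = 0.
Proof.
move=> dS Sb; apply/eqP; apply: contraT; rewrite -normr_gt0 => db_gt0.
have d1_gt0 : 0 < `|d| + 1 by rewrite ltr_wpDl.
have e_gt0 : 0 < `|cmul d b| / (`|d| + 1) by rewrite divr_gt0.
have [y [[n [k [s [Ss yE]]]] by_lt]] := Sb _ (nbhsx_ballx b _ e_gt0).
have dy : cmul d y = 0.
  by rewrite yE cmul_sumr big1// => i _; rewrite dS// scaler0.
move: by_lt; rewrite -ball_normE /= ltr_pdivlMr// => by_lt.
suff : `|cmul d b| < `|cmul d b| by rewrite ltxx.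
apply: le_lt_trans by_lt.
rewrite -[X in `|X| <= _](subr0 (cmul d b)) -dy -cmulBr.
apply: le_trans (norm_cmul _ _) _; rewrite mulrC ler_wpM2l//.
by rewrite lerDl.
Qed.

(** For every c and every s in S, c s lies in S, so that
    c s = alpha (c s) = alpha c s: thus c - alpha c annihilates S from the
    left, hence also its closed linear span.  For d = b - alpha b this gives
    d^* b = 0, as d^* = b^* - alpha b^*, and d^* (alpha b) = 0 in the same way
    after pulling it back along alpha.  Then d^* d = 0. *)
Lemma aut_fix_closure S alpha : is_automorphism alpha ->
  (forall c s, S s -> S (cmul c s)) -> (forall s, S s -> alpha s = s) ->
  forall b, closure (lin_span S) b -> alpha b = b.
Proof.
move=> aalpha SM Sfix b Sb.
have ann c : cmul (c - alpha c) b = 0.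
  apply: cmul_closure_eq0 Sb => s Ss.
  rewrite cmulBl -[X in cmul (alpha c) X]Sfix// -(aut_mul aalpha).
  by rewrite Sfix ?subrr//; exact: SM.
have [beta alphaK betaK] := aut_bij aalpha.
apply/esym/subr0_eq/cstar_cmul_eq0.
rewrite cmulBr cstarB -(aut_star aalpha) ann sub0r.
have -> : cstar b - alpha (cstar b) =
    alpha (beta (cstar b) - alpha (beta (cstar b))).
  by rewrite (autB _ _ aalpha) betaK.
by rewrite -(aut_mul aalpha) ann aut0// oppr0.
Qed.

Lemma aut_agree_closure S phi psi : is_automorphism phi ->
  is_automorphism psi -> (forall c s, S s -> S (cmul c s)) ->
  (forall s, S s -> phi s = psi s) ->
  forall b, closure (lin_span S) b -> phi b = psi b.
Proof.
move=> aphi apsi SM Sagree b Sb; have [psi' psiK psi'K] := aut_bij apsi.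
apply: (can_inj psi'K); rewrite psiK.
apply: (@aut_fix_closure S (psi' \o phi)) Sb => //.
  exact: aut_comp (aut_inv apsi psiK psi'K) aphi.
by move=> s Ss /=; rewrite Sagree.
Qed.

End Automorphisms.

(** * Classes of automorphisms implemented by generalized unitaries *)

Section Classes.
Context {R : realType} {B : cStarAlgType R} {E : hilbertModType B}.
Implicit Types (u v w : E -> E) (phi psi : B -> B).

Lemma cmul_ipl (b : B) (x y : E) : cmul b (ip x y) = ip (mact x (cstar b)) y.
Proof. by rewrite -[RHS]ip_cstar ip_mactr cstarM cstarK ip_cstar. Qed.

Lemma range_ideal_ip (x y : E) : range_ideal E (ip x y).
Proof. by apply/subset_closure/lin_span_sub; exists x, y. Qed.

Lemma phi_unitary_agree phi psi u :
  is_automorphism phi -> is_automorphism psi ->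
  phi_unitary phi u -> phi_unitary psi u ->
  forall b, range_ideal E b -> phi b = psi b.
Proof.
move=> aphi apsi [_ uphi] [_ upsi]; apply: aut_agree_closure => //.
- by move=> c _ [x [y ->]]; exists (mact x (cstar c)), y; exact: cmul_ipl.
- by move=> _ [x [y ->]]; rewrite -uphi upsi.
Qed.

Lemma aut_class_self phi : is_automorphism phi -> aut_class E phi phi.
Proof. by []. Qed.

Lemma eq_aut_class phi psi : (forall b, range_ideal E b -> phi b = psi b) ->
  aut_class E phi = aut_class E psi.
Proof.
by move=> e; apply/seteqP; split=> chi [achi h]; split=> // b Eb;
  rewrite h// e.
Qed.

Lemma phi_unitary_aut_class phi psi u :
  is_automorphism phi -> is_automorphism psi ->
  phi_unitary phi u -> phi_unitary psi u -> aut_class E phi = aut_class E psi.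
Proof.
move=> aphi apsi uphi upsi; apply: eq_aut_class.
exact: phi_unitary_agree uphi upsi.
Qed.

Lemma aut_class_phi_unitary phi psi u :
  aut_class E phi psi -> phi_unitary phi u -> phi_unitary psi u.
Proof.
move=> [_ e] [su uphi]; split=> // x y.
by rewrite uphi e//; exact: range_ideal_ip.
Qed.

Lemma phi_unitary_comp phi psi u v :
  phi_unitary phi u -> phi_unitary psi v -> phi_unitary (phi \o psi) (u \o v).
Proof.
move=> [su uphi] [sv vpsi]; split=> [y|x y /=]; last by rewrite uphi vpsi.
by have [x <-] := su y; have [z <-] := sv x; exists z.
Qed.

Lemma is_unitaryP w : Defs.is_unitary w <-> phi_unitary id w.
Proof.
split=> [[w' [aw wK w'K]]|ww].
  by split=> [y|x y]; [exists (w' y); rewrite w'K | rewrite aw wK].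
have [|w' wK w'K] := @gen_unitary_bij _ _ _ w.
  by exists id => //; exact: aut_id.
exists w'; split=> // x y.
by rewrite -[y in LHS]w'K (phi_unitary_ip ww).
Qed.

(** A product of classes is defined as a union over representatives; all of
    its terms coincide, because the composite of a phi-unitary and a
    psi-unitary implements each of the composite automorphisms. *)
Lemma class_mulE phi psi u v : is_automorphism phi -> is_automorphism psi ->
  phi_unitary phi u -> phi_unitary psi v ->
  class_mul E (aut_class E phi) (aut_class E psi) = aut_class E (phi \o psi).
Proof.
move=> aphi apsi uphi vpsi; apply/seteqP; split=> chi; last first.
  by move=> h; exists phi => //; exists psi.
move=> [phi' cphi'] [psi' cpsi'].
have [[aphi' _] [apsi' _]] := (cphi', cpsi').
rewrite (@phi_unitary_aut_class (phi' \o psi') (phi \o psi) (u \o v))//.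
- exact: aut_comp.
- exact: aut_comp.
- by apply: phi_unitary_comp; [exact: aut_class_phi_unitary uphi
                              |exact: aut_class_phi_unitary vpsi].
- exact: phi_unitary_comp.
Qed.

End Classes.

(** * The quotient by the unitary group *)

Lemma is_group_range (G : groupType) (T : Type) (f : G -> T)
    (op : T -> T -> T) :
  {morph f : x y / x * y >-> op x y} -> is_group (range f) op.
Proof.
move=> fM; split.
- by move=> _ _ [x _ <-] [y _ <-]; exists (x * y).
- by move=> _ _ _ [x _ <-] [y _ <-] [z _ <-]; rewrite -!fM mulgA.
- exists (f 1); split; first by exists 1.
  + by move=> _ [x _ <-]; rewrite -!fM mul1g mulg1.
  + move=> _ [x _ <-]; exists (f x^-1).
    by rewrite -!fM mulVg mulgV; split=> //; exists x^-1.
Qed.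

Section Quotient.
Context {R : realType} {B : cStarAlgType R} {E : hilbertModType B}.
Implicit Types (u v : Ugen E) (phi psi : B -> B).

Definition implemented_aut u : B -> B := s2val (cid2 (UgenP u)).

Lemma implemented_aut_aut u : is_automorphism (implemented_aut u).
Proof. exact: s2valP (cid2 (UgenP u)). Qed.

Lemma implemented_autP u : phi_unitary (implemented_aut u) (val u).
Proof. exact: s2valP' (cid2 (UgenP u)). Qed.

(** Modulo unitaries, a generalized unitary is known by any automorphism that
    it implements; theta is well defined by one direction and injective by the
    other.  The inner product of (u^-1 * v) x and (u^-1 * v) y is compared with
    that of x and y after applying the injective map phi, which turns the
    former into the inner product of v x and v y. *)
Lemma U_coset_unitary phi u v : is_automorphism phi ->
  phi_unitary phi (val u) -> u^-1 * v \in U E <-> phi_unitary phi (val v).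
Proof.
move=> aphi uphi; split=> [/asboolP/is_unitaryP h|vphi].
  have -> : v = u * (u^-1 * v) by rewrite mulgA mulgV mul1g.
  exact: phi_unitary_comp uphi h.
apply/asboolP/is_unitaryP.
have [_ _ [sw _]] := UgenP (u^-1 * v); split=> // x y.
apply: (bij_inj (aut_bij aphi)).
rewrite -(phi_unitary_ip uphi) !val_UgenM /= !val_UgenVK.
by rewrite (phi_unitary_ip vphi).
Qed.

Definition theta (q : UgenQ E) : set (B -> B) :=
  aut_class E (implemented_aut (repr q)).

Lemma theta_pi phi u : is_automorphism phi -> phi_unitary phi (val u) ->
  theta (\pi_(UgenQ E) u) = aut_class E phi.
Proof.
move=> aphi uphi; apply: phi_unitary_aut_class (implemented_autP _) _ => //.
  exact: implemented_aut_aut.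
exact/(U_coset_unitary _ aphi uphi)/UgenQ_repr.
Qed.

Lemma thetaM : {morph theta : x y / x * y >-> class_mul E x y}.
Proof.
elim/quotW=> u; elim/quotW=> v.
have [au av] := (implemented_aut_aut u, implemented_aut_aut v).
have [uu vv] := (implemented_autP u, implemented_autP v).
rewrite -[_ * _]UgenQ_piM (theta_pi au uu) (theta_pi av vv).
rewrite (class_mulE au av uu vv); apply: theta_pi; first exact: aut_comp.
exact: phi_unitary_comp.
Qed.

Lemma theta_inj : injective theta.
Proof.
elim/quotW=> u; elim/quotW=> v.
have [au av] := (implemented_aut_aut u, implemented_aut_aut v).
have [uu vv] := (implemented_autP u, implemented_autP v).
rewrite (theta_pi au uu) (theta_pi av vv) => uv.
apply/UgenQ_eqP/(U_coset_unitary _ au uu).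
by apply: aut_class_phi_unitary vv; rewrite -uv; exact: aut_class_self.
Qed.

Lemma range_theta : range theta = Phi E.
Proof.
apply/seteqP; split=> [_ [q _ <-]|_ [phi [aphi [u uphi]] <-]].
  exists (implemented_aut (repr q)) => //; split.
    exact: implemented_aut_aut.
  by exists (val (repr q)); exact: implemented_autP.
have gu : gen_unitary u by exists phi.
by exists (\pi_(UgenQ E) (MkUgen gu)) => //; exact: theta_pi.
Qed.

End Quotient.

Theorem corollary1p17 (R : realType) (B : cStarAlgType R)
    (E : hilbertModType B) :
  [/\ forall u v : Ugen E, v \in U E -> v ^ u \in U E,
      is_group (Phi E) (class_mul E),
      forall phi psi : B -> B,
        is_automorphism phi -> is_automorphism psi ->
        (exists u : E -> E, phi_unitary phi u) ->
        (exists u : E -> E, phi_unitary psi u) ->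
        class_mul E (aut_class E phi) (aut_class E psi) =
        aut_class E (phi \o psi)
    & exists theta : UgenQ E -> set (B -> B),
        [/\ set_bij setT (Phi E) theta,
            {morph theta : x y / x * y >-> class_mul E x y}
          & forall (phi : B -> B) (u : Ugen E),
              is_automorphism phi -> phi_unitary phi (val u) ->
              theta (\pi_(UgenQ E) u) = aut_class E phi]].
Proof.
split.
- exact: U_normal.
- rewrite -range_theta; exact: is_group_range thetaM.
- by move=> phi psi aphi apsi [u uphi] [v vpsi]; exact: class_mulE uphi vpsi.
exists theta; split; [split | exact: thetaM | exact: theta_pi].
- by move=> q _; rewrite -range_theta; exists q.
- by move=> x y _ _; exact: theta_inj.
- by move=> X; rewrite -range_theta.
Qed.
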